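(* For every set of formulas $\Delta\subseteq\mathcal{L}_1$ and every formula $\varphi\in\mathcal{L}_1$: if $\Delta\vDash\varphi$ then $\Delta\vdash\varphi$ (strong completeness of $\mathbb{SPIL}_1$).
   Context: Fix a set of constants $\mathbb{C}$. The language $\mathcal{L}_1$ is given by $\varphi ::= \top \mid \lnot\varphi \mid \varphi\land\varphi \mid \mathit{Kv}(c) \mid [c]\varphi$ with $c\in\mathbb{C}$; $\langle c\rangle\varphi:=\lnot[c]\lnot\varphi$. A model is $\mathcal{M}=\langle S,\mathcal{D},V\rangle$ with $S$ a non-empty set of states, $\mathcal{D}$ a non-empty domain, $V:S\times\mathbb{C}\to\mathcal{D}$; $s=_c t$ means $V(s,c)=V(t,c)$. Semantics: booleans as usual; $\mathcal{M},s\vDash\mathit{Kv}(c)$ iff $s=_c t$ for all $t\in S$; $\mathcal{M},s\vDash[c]\varphi$ iff $\mathcal{M}|^s_c,s\vDash\varphi$, where $\mathcal{M}|^s_c=\langle S',\mathcal{D},V|_{S'\times\mathbb{C}}\rangle$ with $S'=\{t\in S\mid s=_c t\}$. $\Delta\vDash\varphi$ means: for every model $\mathcal{M}$ and state $s$, if $\mathcal{M},s\vDash\psi$ for all $\psi\in\Delta$ then $\mathcal{M},s\vDash\varphi$. The proof system $\mathbb{SPIL}_1$ has axioms TAUT (propositional tautologies), DIST $[c](\varphi\to\psi)\to([c]\varphi\to[c]\psi)$, LEARN $[c]\mathit{Kv}(c)$, NF $\mathit{Kv}(c)\to[d]\mathit{Kv}(c)$, DET $\langle c\rangle\varphi\leftrightarrow[c]\varphi$,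 COMM $[c][d]\varphi\leftrightarrow[d][c]\varphi$, IR $\mathit{Kv}(c)\to([c]\varphi\to\varphi)$, and rules MP and NEC (from $\varphi$ infer $[c]\varphi$); $\Delta\vdash\varphi$ means $\varphi$ is derivable from premises in $\Delta$ (with NEC applied only to theorems, i.e. $\Delta\vdash\varphi$ iff $\vdash(\psi_1\land\dots\land\psi_k)\to\varphi$ for some $\psi_1,\dots,\psi_k\in\Delta$). *)

(* Defs.v *)
From Stdlib Require Import List.

Set Implicit Arguments.

Inductive formula (C : Type) : Type :=
| Top : formula C
| Neg : formula C -> formula C
| And : formula C -> formula C -> formula C
| Kv : C -> formula C
| Box : C -> formula C -> formula C.

Arguments Top {C}.

Definition Imp {C : Type} (phi psi : formula C) : formula C :=
  Neg (And phi (Neg psi)).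

Definition Iff {C : Type} (phi psi : formula C) : formula C :=
  And (Imp phi psi) (Imp psi phi).

Definition Dia {C : Type} (c : C) (phi : formula C) : formula C :=
  Neg (Box c (Neg phi)).

(** The empty conjunction is [Top], and a nonempty one ends in a harmless
    conjunct [Top]. *)
Definition Conj {C : Type} (l : list (formula C)) : formula C :=
  fold_right (@And C) Top l.

Record model (C : Type) : Type := Model {
  state : Type;
  domain : Type;
  state_nonempty : inhabited state;
  domain_nonempty : inhabited domain;
  val : state -> C -> domain
}.

Arguments val {C} m s c.

(** [agree M c s t] is the relation [s =_c t]. *)
Definition agree {C : Type} (M : model C) (c : C) (s t : state M) : Prop :=
  val M s c = val M t c.

Definition substate {C : Type} (M : model C) (s : state M) (c : C) : Type :=
  {t : state M | agree M c s t}.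

(** The state [s], regarded as a state of the restriction of [M] to the
    states agreeing with [s] on [c]. *)
Definition here {C : Type} (M : model C) (s : state M) (c : C)
  : substate M s c :=
  exist (agree M c s) s eq_refl.

Definition restrict {C : Type} (M : model C) (s : state M) (c : C) : model C :=
  {| state := substate M s c;
     domain := domain M;
     state_nonempty := inhabits (here M s c);
     domain_nonempty := domain_nonempty M;
     val := fun t d => val M (proj1_sig t) d |}.

Fixpoint sat {C : Type} (M : model C) (s : state M) (phi : formula C) : Prop :=
  match phi with
  | Top => True
  | Neg psi => ~ sat M s psi
  | And psi chi => sat M s psi /\ sat M s chi
  | Kv c => forall t : state M, agree M c s t
  | Box c psi => sat (restrict M s c) (here M s c) psi
  end.

Definition entails {C : Type} (Delta : formula C -> Prop) (phi : formula C)
  : Prop :=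
  forall (M : model C) (s : state M),
    (forall psi : formula C, Delta psi -> sat M s psi) -> sat M s phi.

(** Truth-table evaluation: formulas of the form [Kv c] and [Box c psi] are
    propositional atoms, whose truth values are given by [v]. *)
Fixpoint truth_value {C : Type} (v : formula C -> bool) (phi : formula C)
  : bool :=
  match phi with
  | Top => true
  | Neg psi => negb (truth_value v psi)
  | And psi chi => andb (truth_value v psi) (truth_value v chi)
  | Kv _ | Box _ _ => v phi
  end.

Definition tautology {C : Type} (phi : formula C) : Prop :=
  forall v : formula C -> bool, truth_value v phi = true.

Inductive theorem_of_SPIL1 {C : Type} : formula C -> Prop :=
| TAUT (phi : formula C) :
    tautology phi -> theorem_of_SPIL1 phi
| DIST (c : C) (phi psi : formula C) :
    theorem_of_SPIL1 (Imp (Box c (Imp phi psi)) (Imp (Box c phi) (Box c psi)))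
| LEARN (c : C) :
    theorem_of_SPIL1 (Box c (Kv c))
| NF (c d : C) :
    theorem_of_SPIL1 (Imp (Kv c) (Box d (Kv c)))
| DET (c : C) (phi : formula C) :
    theorem_of_SPIL1 (Iff (Dia c phi) (Box c phi))
| COMM (c d : C) (phi : formula C) :
    theorem_of_SPIL1 (Iff (Box c (Box d phi)) (Box d (Box c phi)))
| IR (c : C) (phi : formula C) :
    theorem_of_SPIL1 (Imp (Kv c) (Imp (Box c phi) phi))
| MP (phi psi : formula C) :
    theorem_of_SPIL1 phi -> theorem_of_SPIL1 (Imp phi psi) ->
    theorem_of_SPIL1 psi
| NEC (c : C) (phi : formula C) :
    theorem_of_SPIL1 phi -> theorem_of_SPIL1 (Box c phi).

Definition derives {C : Type} (Delta : formula C -> Prop) (phi : formula C)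
  : Prop :=
  exists l : list (formula C),
    (forall psi : formula C, In psi l -> Delta psi) /\
    theorem_of_SPIL1 (Imp (Conj l) phi).

(* Main.v *)
(** Let [G] be maximal among the sets containing [Delta] from which [phi] is
    not derivable.  For a finite list [X] of constants let [boxes X] be the
    corresponding sequence of boxes.  By DET these commute with the Boolean
    connectives, so [G] is determined by the set of pairs [(X, d)] with
    [boxes X (Kv d)] in [G].  By LEARN, NF, COMM and IR the map
    [X |-> {d | boxes X (Kv d) in G}] is a closure operator on lists of
    constants.  Such an operator is realised by a model with a distinguished
    state [s] and, for each [Y], a state agreeing with [s] exactly on the
    closure of [Y]; this model satisfies [G] at [s]. *)
Require Import Defs.
From Stdlib Require Import List Classical PropExtensionality.
From mathcomp Require classical_sets.
Import ListNotations.

Set Implicit Arguments.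

(** * Propositional reasoning and the laws of a single box *)

Ltac taut :=
  let v := fresh "v" in
  intro v; cbn [Imp Iff Dia truth_value];
  repeat match goal with
  | |- context [truth_value v ?A] => destruct (truth_value v A)
  | |- context [v ?A] => destruct (v A)
  end; reflexivity.

Lemma theorem_taut_mp {C : Type} (A B : formula C) :
  theorem_of_SPIL1 A -> tautology (Imp A B) -> theorem_of_SPIL1 B.
Proof. intros HA HAB. exact (MP HA (TAUT HAB)). Qed.

Lemma theorem_taut_mp2 {C : Type} (A B D : formula C) :
  theorem_of_SPIL1 A -> theorem_of_SPIL1 B -> tautology (Imp A (Imp B D)) ->
  theorem_of_SPIL1 D.
Proof. intros HA HB HABD. exact (MP HB (MP HA (TAUT HABD))). Qed.

Lemma Imp_trans {C : Type} (A B D : formula C) :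
  theorem_of_SPIL1 (Imp A B) -> theorem_of_SPIL1 (Imp B D) ->
  theorem_of_SPIL1 (Imp A D).
Proof. intros HAB HBD. apply (theorem_taut_mp2 HAB HBD). taut. Qed.

Lemma Iff_trans {C : Type} (A B D : formula C) :
  theorem_of_SPIL1 (Iff A B) -> theorem_of_SPIL1 (Iff B D) ->
  theorem_of_SPIL1 (Iff A D).
Proof. intros HAB HBD. apply (theorem_taut_mp2 HAB HBD). taut. Qed.

Lemma Iff_l {C : Type} (A B : formula C) :
  theorem_of_SPIL1 (Iff A B) -> theorem_of_SPIL1 (Imp A B).
Proof. intros H. apply (theorem_taut_mp H). taut. Qed.

Lemma Iff_r {C : Type} (A B : formula C) :
  theorem_of_SPIL1 (Iff A B) -> theorem_of_SPIL1 (Imp B A).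
Proof. intros H. apply (theorem_taut_mp H). taut. Qed.

Lemma Box_Imp {C : Type} (c : C) (A B : formula C) :
  theorem_of_SPIL1 (Imp A B) -> theorem_of_SPIL1 (Imp (Box c A) (Box c B)).
Proof. intros H. exact (MP (NEC c H) (DIST c A B)). Qed.

Lemma Box_Iff {C : Type} (c : C) (A B : formula C) :
  theorem_of_SPIL1 (Iff A B) -> theorem_of_SPIL1 (Iff (Box c A) (Box c B)).
Proof.
  intros H.
  apply (theorem_taut_mp2 (Box_Imp c (Iff_l H)) (Box_Imp c (Iff_r H))). taut.
Qed.

(** Since [Dia c A] unfolds to [Neg (Box c (Neg A))], this is DET up to propositional reasoning. *)
Lemma Box_Neg {C : Type} (c : C) (A : formula C) :
  theorem_of_SPIL1 (Iff (Box c (Neg A)) (Neg (Box c A))).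
Proof. apply (theorem_taut_mp (DET c A)). taut. Qed.

Lemma Box_And {C : Type} (c : C) (A B : formula C) :
  theorem_of_SPIL1 (Iff (Box c (And A B)) (And (Box c A) (Box c B))).
Proof.
  assert (HA : theorem_of_SPIL1 (Imp (Box c (And A B)) (Box c A))).
  { apply Box_Imp, TAUT. taut. }
  assert (HB : theorem_of_SPIL1 (Imp (Box c (And A B)) (Box c B))).
  { apply Box_Imp, TAUT. taut. }
  assert (HAB : theorem_of_SPIL1
                  (Imp (Box c A) (Imp (Box c B) (Box c (And A B))))).
  { apply Imp_trans with (Box c (Imp B (And A B))).
    - apply Box_Imp, TAUT. taut.
    - apply DIST. }
  (* [theorem_taut_mp2] combines two theorems at a time, so [HB] and [HAB] are first packed into the
     conjunction [D]. *)
  apply (theorem_taut_mp2 HA (theorem_taut_mp2 HB HAB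
    (D := And (Imp (Box c (And A B)) (Box c B))
              (Imp (Box c A) (Imp (Box c B) (Box c (And A B)))))
    ltac:(taut))).
  taut.
Qed.

(** * Sequences of boxes *)

Definition boxes {C : Type} (X : list C) (A : formula C) : formula C :=
  fold_right (@Box C) A X.

Lemma boxes_app {C : Type} (X Y : list C) (A : formula C) :
  boxes (X ++ Y) A = boxes X (boxes Y A).
Proof. apply fold_right_app. Qed.

Lemma boxes_nec {C : Type} (X : list C) (A : formula C) :
  theorem_of_SPIL1 A -> theorem_of_SPIL1 (boxes X A).
Proof. intros H. induction X; [exact H | now apply NEC]. Qed.

Lemma boxes_Imp {C : Type} (X : list C) (A B : formula C) :
  theorem_of_SPIL1 (Imp A B) ->
  theorem_of_SPIL1 (Imp (boxes X A) (boxes X B)).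
Proof. intros H. induction X; [exact H | now apply Box_Imp]. Qed.

Lemma boxes_dist {C : Type} (X : list C) (A B : formula C) :
  theorem_of_SPIL1 (Imp (boxes X (Imp A B)) (Imp (boxes X A) (boxes X B))).
Proof.
  induction X as [|c X IH].
  - apply TAUT. cbn [boxes fold_right]. taut.
  - exact (Imp_trans (Box_Imp c IH) (DIST c _ _)).
Qed.

Lemma boxes_Neg {C : Type} (X : list C) (A : formula C) :
  theorem_of_SPIL1 (Iff (boxes X (Neg A)) (Neg (boxes X A))).
Proof.
  induction X as [|c X IH].
  - apply TAUT. cbn [boxes fold_right]. taut.
  - exact (Iff_trans (Box_Iff c IH) (Box_Neg c _)).
Qed.

Lemma boxes_And {C : Type} (X : list C) (A B : formula C) :
  theorem_of_SPIL1 (Iff (boxes X (And A B)) (And (boxes X A) (boxes X B))).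
Proof.
  induction X as [|c X IH].
  - apply TAUT. cbn [boxes fold_right]. taut.
  - exact (Iff_trans (Box_Iff c IH) (Box_And c _ _)).
Qed.

Lemma boxes_comm {C : Type} (X : list C) (c : C) (A : formula C) :
  theorem_of_SPIL1 (Iff (boxes X (Box c A)) (Box c (boxes X A))).
Proof.
  induction X as [|d X IH].
  - apply TAUT. cbn [boxes fold_right]. taut.
  - exact (Iff_trans (Box_Iff d IH) (COMM d c _)).
Qed.

(** COMM lets the box of [c] move innermost, where LEARN applies. This makes the closure operator
    extensive. *)
Lemma boxes_learn {C : Type} (X : list C) (c : C) :
  In c X -> theorem_of_SPIL1 (boxes X (Kv c)).
Proof.
  induction X as [|d X IH]; [contradiction|].
  intros [->|Hc].
  - exact (MP (boxes_nec X (LEARN c)) (Iff_l (boxes_comm X c (Kv c)))).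
  - exact (NEC d (IH Hc)).
Qed.

(** NF creates each new box directly in front of [Kv d], and COMM carries it out past [Y]. *)
Lemma boxes_persist {C : Type} (Z Y : list C) (d : C) :
  theorem_of_SPIL1 (Imp (boxes Y (Kv d)) (boxes Z (boxes Y (Kv d)))).
Proof.
  induction Z as [|c Z IH].
  - apply TAUT. cbn [boxes fold_right]. taut.
  - apply Imp_trans with (Box c (boxes Y (Kv d))).
    + exact (Imp_trans (boxes_Imp Y (NF d c)) (Iff_l (boxes_comm Y c _))).
    + exact (Box_Imp c IH).
Qed.

Lemma boxes_remove {C : Type} (Z : list C) (c : C) (A : formula C) :
  theorem_of_SPIL1
    (Imp (boxes Z (Kv c)) (Imp (boxes Z (Box c A)) (boxes Z A))).
Proof. exact (Imp_trans (boxes_Imp Z (IR c A)) (boxes_dist Z _ _)). Qed.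

(** * Derivability from premises *)

Lemma truth_value_Conj {C : Type} (v : formula C -> bool)
  (l : list (formula C)) :
  truth_value v (Conj l) = true <->
  forall psi, In psi l -> truth_value v psi = true.
Proof.
  induction l as [|A l IH]; cbn.
  - split; [intros _ _ [] | reflexivity].
  - rewrite Bool.andb_true_iff. fold (Conj l). rewrite IH. split.
    + intros [HA Hl] psi [<-|Hpsi]; auto.
    + auto.
Qed.

Lemma Conj_incl {C : Type} (l l' : list (formula C)) :
  incl l l' -> theorem_of_SPIL1 (Imp (Conj l') (Conj l)).
Proof.
  intros Hl. apply TAUT. intros v. cbn.
  destruct (truth_value v (Conj l')) eqn:E'; [|reflexivity].
  assert (E : truth_value v (Conj l) = true).
  { rewrite truth_value_Conj in *. auto. }
  now rewrite E.
Qed.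

Lemma derives_weaken {C : Type} (G G' : formula C -> Prop) (A : formula C) :
  (forall psi, G psi -> G' psi) -> derives G A -> derives G' A.
Proof. intros HG [l [Hl HA]]. exists l. auto. Qed.

Lemma derives_in {C : Type} (G : formula C -> Prop) (A : formula C) :
  G A -> derives G A.
Proof.
  intros HA. exists [A]. split.
  - intros psi [<-|[]]. exact HA.
  - apply TAUT. cbn [Conj fold_right]. taut.
Qed.

Lemma derives_theorem {C : Type} (G : formula C -> Prop) (A : formula C) :
  theorem_of_SPIL1 A -> derives G A.
Proof.
  intros HA. exists []. split; [intros _ []|].
  apply (theorem_taut_mp HA). cbn [Conj fold_right]. taut.
Qed.

Lemma derives_mp {C : Type} (G : formula C -> Prop) (A B : formula C) :
  derives G (Imp A B) -> derives G A -> derives G B.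
Proof.
  intros [l [Hl HAB]] [l' [Hl' HA]]. exists (l ++ l'). split.
  - intros psi Hpsi. apply in_app_or in Hpsi as [H|H]; auto.
  - pose proof (Imp_trans (Conj_incl (incl_appl l' (incl_refl l))) HAB) as H1.
    pose proof (Imp_trans (Conj_incl (incl_appr l (incl_refl l'))) HA) as H2.
    apply (theorem_taut_mp2 H1 H2). taut.
Qed.

Lemma derives_deduction {C : Type} (G : formula C -> Prop) (A B : formula C) :
  derives (fun psi => G psi \/ psi = A) B -> derives G (Imp A B).
Proof.
  intros [l [Hl HB]].
  (* All occurrences of [A] as an added premise, however many, are gathered into a single one at the
     head. *)
  assert (Hl' : exists l', (forall psi, In psi l' -> G psi) /\
                  incl l (A :: l')).
  { clear HB. induction l as [|psi l IH].
    - exists []. split; [intros _ [] | intros _ []].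
    - destruct IH as [l' [Hl' Hincl]].
      { intros chi Hchi. apply Hl. now right. }
      destruct (Hl psi (or_introl eq_refl)) as [Hpsi | ->].
      + exists (psi :: l'). split.
        * intros chi [<-|Hchi]; auto.
        * intros chi [<-|Hchi]; [right; now left|].
          destruct (Hincl chi Hchi); [now left | right; now right].
      + exists l'. split; [assumption|].
        intros chi [<-|Hchi]; [now left | auto]. }
  destruct Hl' as [l' [Hl' Hincl]].
  exists l'. split; [assumption|].
  apply (theorem_taut_mp (Imp_trans (Conj_incl Hincl) HB)).
  change (Conj (A :: l')) with (And A (Conj l')). taut.
Qed.

Arguments derives_deduction {C G A B} _.

(** * Maximal sets from which a given formula is not derivable *)

Record maximal_avoiding {C : Type} (phi : formula C) (G : formula C -> Prop)
  : Prop := {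
  avoids : ~ derives G phi;
  maximal : forall A, ~ G A -> derives (fun psi => G psi \/ psi = A) phi
}.

Lemma Lindenbaum {C : Type} (Delta : formula C -> Prop) (phi : formula C) :
  ~ derives Delta phi ->
  exists G, (forall psi, Delta psi -> G psi) /\ maximal_avoiding phi G.
Proof.
  intros Hphi.
  (* Zorn's lemma is applied to the sets [A] added to [Delta], not to supersets of [Delta]: the
     empty chain has empty union, which is then admissible by [Hphi]. *)
  pose (join := fun A psi => Delta psi \/ A psi : Prop).
  destruct (classical_sets.Zorn_bigcup
              (P := fun A => ~ derives (join A) phi)) as [A [HA Hmax]].
  - intros F HF Htot [l [Hl Hd]].
    (* A derivation has finitely many premises, so one member of the chain supplies all those
       outside [Delta]. *)
    assert (H : (forall psi, In psi l -> Delta psi) \/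
                exists2 X, F X & forall psi, In psi l -> join X psi).
    { clear Hd. induction l as [|A l IH]; [left; intros _ []|].
      assert (HA := Hl A (or_introl eq_refl)).
      destruct IH as [IH | [X HX IH]].
      - intros psi Hpsi. apply Hl. now right.
      - destruct HA as [HA | [Y HY HA]].
        + left. intros psi [<-|Hpsi]; auto.
        + right. exists Y; [exact HY|].
          intros psi [<-|Hpsi]; [now right | left; auto].
      - right. destruct HA as [HA | [Y HY HA]].
        + exists X; [exact HX|]. intros psi [<-|Hpsi]; [now left | auto].
        + destruct (Htot X Y HX HY) as [HXY | HYX].
          * exists Y; [exact HY|]. intros psi [<-|Hpsi]; [now right|].
            destruct (IH psi Hpsi); [now left | right; now apply HXY].
          * exists X; [exact HX|].
            intros psi [<-|Hpsi]; [right; now apply HYX | auto]. }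
    destruct H as [H | [X HX H]].
    + apply Hphi. now exists l.
    + apply (HF X HX). now exists l.
  - exists (join A). split; [now left|]. split; [exact HA|].
    intros B HB. apply NNPP. intros Hn.
    apply (Hmax (fun psi => A psi \/ psi = B)).
    + split; [now left|]. intros Hsub. apply HB. right. apply Hsub. now right.
    + intros Hd. apply Hn. revert Hd. apply derives_weaken.
      unfold join. tauto.
Qed.

(** * Membership in a maximal set and the canonical model *)

Section MaximalSet.

Context {C : Type} {phi : formula C} {G : formula C -> Prop}
  (HG : maximal_avoiding phi G).

Lemma maximal_closed (A : formula C) : derives G A -> G A.
Proof.
  intros HA. apply NNPP. intros Hn. apply (avoids HG).
  exact (derives_mp (derives_deduction (maximal HG A Hn)) HA).
Qed.

Lemma maximal_theorem (A : formula C) : theorem_of_SPIL1 A -> G A.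
Proof. intros HA. now apply maximal_closed, derives_theorem. Qed.

Lemma maximal_mp (A B : formula C) : theorem_of_SPIL1 (Imp A B) -> G A -> G B.
Proof.
  intros HAB HA. apply maximal_closed.
  exact (derives_mp (derives_theorem G HAB) (derives_in G A HA)).
Qed.

Lemma maximal_mp2 (A B D : formula C) :
  theorem_of_SPIL1 (Imp A (Imp B D)) -> G A -> G B -> G D.
Proof.
  intros H HA HB. apply maximal_closed.
  exact (derives_mp (derives_in G _ (maximal_mp H HA)) (derives_in G B HB)).
Qed.

(** If both [A] and [Neg A] were missing, [phi] would follow from either one added to [G], hence by
    cases from [G] alone. *)
Lemma maximal_Neg (A : formula C) : G (Neg A) <-> ~ G A.
Proof.
  split.
  - intros HN HA. apply (avoids HG), derives_in.
    refine (maximal_mp2 _ HN HA). apply TAUT. taut.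
  - intros HA. apply NNPP. intros HN. apply (avoids HG).
    pose proof (derives_deduction (maximal HG A HA)) as H1.
    pose proof (derives_deduction (maximal HG (Neg A) HN)) as H2.
    refine (derives_mp (derives_mp (derives_theorem G _) H1) H2).
    apply TAUT. taut.
Qed.

Lemma maximal_And (A B : formula C) : G (And A B) <-> G A /\ G B.
Proof.
  split.
  - intros H. split; refine (maximal_mp _ H); apply TAUT; taut.
  - intros [HA HB]. refine (maximal_mp2 _ HA HB). apply TAUT. taut.
Qed.

Lemma maximal_Iff (A B : formula C) :
  theorem_of_SPIL1 (Iff A B) -> (G A <-> G B).
Proof.
  intros H. split; apply maximal_mp; [now apply Iff_l | now apply Iff_r].
Qed.

Lemma maximal_boxes_Neg (X : list C) (A : formula C) :
  G (boxes X (Neg A)) <-> ~ G (boxes X A).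
Proof. rewrite (maximal_Iff (boxes_Neg X A)). apply maximal_Neg. Qed.

Lemma maximal_boxes_And (X : list C) (A B : formula C) :
  G (boxes X (And A B)) <-> G (boxes X A) /\ G (boxes X B).
Proof. rewrite (maximal_Iff (boxes_And X A B)). apply maximal_And. Qed.

(** Put [boxes Z] in front of [boxes Y (Kv d)], then strip the boxes of [Y] one by one with IR. This
    gives monotonicity and idempotence of the closure operator. *)
Lemma maximal_boxes_cut (Z Y : list C) (d : C) :
  (forall c, In c Y -> G (boxes Z (Kv c))) -> G (boxes Y (Kv d)) ->
  G (boxes Z (Kv d)).
Proof.
  intros HY Hd. apply (maximal_mp (boxes_persist Z Y d)) in Hd.
  induction Y as [|c Y IH]; [exact Hd|].
  apply IH.
  - intros e He. apply HY. now right.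
  - refine (maximal_mp2 (boxes_remove Z c _) _ Hd). apply HY. now left.
Qed.

(** Announcing [c] at [s] turns the pair [(M, X)] into
    [(restrict M s c, X ++ [c])], for which the hypothesis holds again;
    hence the generality in [M] and [X]. *)
Lemma truth_lemma (A : formula C) : forall (M : model C) (s : state M) X,
  (forall Y d,
     (forall t : state M, (forall c, In c Y -> agree M c s t) ->
        agree M d s t) <-> G (boxes (X ++ Y) (Kv d))) ->
  (sat M s A <-> G (boxes X A)).
Proof.
  induction A as [|A IH|A IHA B IHB|c|c A IH]; intros M s X HX; cbn [sat].
  - split; [intros _ | trivial].
    apply maximal_theorem, boxes_nec, TAUT. taut.
  - rewrite maximal_boxes_Neg. now rewrite (IH M s X HX).
  - rewrite maximal_boxes_And. now rewrite (IHA M s X HX), (IHB M s X HX).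
  - specialize (HX [] c). rewrite app_nil_r in HX. rewrite <- HX.
    split; [auto | intros H t; apply H; intros _ []].
  - change (boxes X (Box c A)) with (boxes X (boxes [c] A)).
    rewrite <- boxes_app. apply IH.
    (* States of the restriction agreeing with [s] on [Y] are the states of [M] agreeing with [s] on
       [c :: Y]. *)
    intros Y d. rewrite <- app_assoc. cbn [app]. rewrite <- HX. split.
    + intros H t Ht.
      refine (H (exist _ t (Ht c (or_introl eq_refl))) _).
      intros e He. apply Ht. now right.
    + intros H [t Hct] Ht. apply H.
      intros e [<-|He]; [exact Hct | exact (Ht e He)].
Qed.

(** [None] is the distinguished state; [Some Y] agrees with it on [c] exactly
    when [boxes Y (Kv c)] is in [G], the domain being the truth values. *)
Definition canonical_model : model C := {|
  state := option (list C);
  domain := Prop;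
  state_nonempty := inhabits None;
  domain_nonempty := inhabits True;
  val := fun t c => match t with
                    | None => True
                    | Some Y => G (boxes Y (Kv c))
                    end
|}.

(** Agreement with [None] is an equality between [True] and a proposition, which by extensionality
    means that the proposition holds. *)
Lemma canonical_agree (Y : list C) (c : C) :
  agree canonical_model c None (Some Y) <-> G (boxes Y (Kv c)).
Proof.
  unfold agree. cbn. split.
  - intros <-. exact I.
  - intros H. now apply propositional_extensionality.
Qed.

Lemma canonical_truth (A : formula C) :
  sat canonical_model None A <-> G A.
Proof.
  apply (@truth_lemma A canonical_model None []).
  intros Y d. cbn [app]. split.
  (* The state [Some Y] is the test case: it agrees with [None] on all of [Y]. *)
  - intros H. apply canonical_agree, H.
    intros c Hc. apply canonical_agree, maximal_theorem. now apply boxes_learn.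
  - intros Hd [Z|] HZ; [|reflexivity].
    apply canonical_agree. refine (@maximal_boxes_cut Z Y d _ Hd).
    intros c Hc. now apply canonical_agree, HZ.
Qed.

End MaximalSet.

Theorem theorem1 (C : Type) (Delta : formula C -> Prop) (phi : formula C) :
  entails Delta phi -> derives Delta phi.
Proof.
  intros Hent. apply NNPP. intros Hn.
  destruct (Lindenbaum Hn) as [G [Hsub HG]].
  apply (avoids HG), derives_in, (canonical_truth HG), Hent.
  intros psi Hpsi. apply (canonical_truth HG). auto.
Qed.
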